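(* Let $n\ge 3$ and $2\le k\le n-1$. If, for all $I\in\mathcal{I}(k;n)$, the parameters $p_I<1$ are sufficiently close to $1$ (i.e. there is $\delta=\delta(n,k)\in(0,1)$ such that the following holds whenever $1-\delta<p_I<1$ for all $I\in\mathcal{I}(k;n)$), then there exist $c=c(\mathbf{p})>0$ and $\alpha=\alpha(\mathbf{p})>0$ such that $$\mathbb{P}_{\mathbf{p}}\big(o\leftrightarrow\partial B(K),\ o\nleftrightarrow\infty\big)\ \ge\ c\,K^{-\alpha}$$ for every integer $K>0$.
   Context: Let $[n]=\{1,\dots,n\}$ and $\mathcal{I}=\mathcal{I}(k;n)=\{I\subset[n]:\#I=k\}$. For $I\in\mathcal{I}$ let $\mathbb{Z}^k_I=\{\sum_{i\in I}x_ie_i: x_i\in\mathbb{Z}\}\subset\mathbb{Z}^n$ and let $\pi_I:\mathbb{Z}^n\to\mathbb{Z}^k_I$ be the orthogonal projection $\pi_I(\sum_{i=1}^n x_ie_i)=\sum_{i\in I}x_ie_i$. Given $\mathbf{p}=(p_I)_{I\in\mathcal{I}}\in[0,1]^{\mathcal{I}}$, let $\omega_I=(\omega_I(u))_{u\in\mathbb{Z}^k_I}$ be i.i.d. Bernoulli random variables with mean $p_I$, the families $\omega_I$, $I\in\mathcal{I}$, being independent of each other. The Bernoulli $(n,k)$-hyperplane percolation is the process $\omega\in\{0,1\}^{\mathbb{Z}^n}$, $\omega(v)=\prod_{I\in\mathcal{I}}\omega_I(\pi_I(v))$, and $\mathbb{P}_{\mathbf{p}}$ denotes its law. A site $v$ is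 $\omega$-open if $\omega(v)=1$. Sites are adjacent in $\mathbb{Z}^n$ if they are at Euclidean distance $1$. With $o$ the origin, $[o\leftrightarrow\infty]$ is the event that $o$ belongs to an infinite connected component of $\omega$-open sites, $[o\nleftrightarrow\infty]$ is its complement, and $[o\leftrightarrow\partial B(K)]$ is the event that $o$ is connected, by a nearest-neighbour path of $\omega$-open sites, to some vertex at $l_\infty$-distance $K$ from $o$. *)

(* Defs.v *)
From HB Require Import structures.
From mathcomp Require Import all_boot all_order all_algebra finmap.
From mathcomp Require Import all_classical all_reals all_analysis.

Set Implicit Arguments.
Unset Strict Implicit.
Unset Printing Implicit Defensive.

Import Order.TTheory GRing.Theory Num.Theory.

Local Open Scope classical_set_scope.
Local Open Scope ring_scope.

(* The coordinate set [n] is 'I_n and the lattice Z^n is 'rV[int]_n. *)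
Definition ksubset (n k : nat) := {I : {set 'I_n} | #|I| == k}.

Definition in_coord_plane n (I : {set 'I_n}) (u : 'rV[int]_n) : bool :=
  [forall i, (i \notin I) ==> (u 0 i == 0)].

Definition coord_plane n k (I : ksubset n k) :=
  {u : 'rV[int]_n | in_coord_plane (val I) u}.

Definition coord_proj n (I : {set 'I_n}) (v : 'rV[int]_n) : 'rV[int]_n :=
  \row_i (if i \in I then v 0 i else 0).

Lemma coord_projP n (I : {set 'I_n}) (v : 'rV[int]_n) :
  in_coord_plane I (coord_proj I v).
Proof. by apply/forallP => i; apply/implyP => /negPf iI; rewrite mxE iI. Qed.

Definition plane_proj n k (I : ksubset n k) (v : 'rV[int]_n) : coord_plane I :=
  exist _ (coord_proj (val I) v) (coord_projP (val I) v).

(* With {0,1} rendered as bool, the product over I is a conjunction. *)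
Definition hyperplane_process n k
    (omega : forall I : ksubset n k, coord_plane I -> bool) :
    'rV[int]_n -> bool :=
  fun v => \big[andb/true]_(I : ksubset n k) omega I (plane_proj I v).

(* Euclidean distance 1, stated through its square to stay in int. *)
Definition adjacent n : rel 'rV[int]_n :=
  fun u v => \sum_i (u 0 i - v 0 i) ^+ 2 == 1.

Definition linf_dist n (u v : 'rV[int]_n) : nat :=
  \max_(i < n) `|(u 0 i - v 0 i)%R|%N.

(* All sites of the path, both endpoints included, have to be open; the
   cluster of a closed site is empty. *)
Definition open_cluster n (w : 'rV[int]_n -> bool) (x : 'rV[int]_n) :
    set 'rV[int]_n :=
  [set y | exists s : seq 'rV[int]_n,
    [/\ path (@adjacent n) x s, last x s = y & all w (x :: s)]].

Definition origin_to_infty n : set ('rV[int]_n -> bool) :=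
  [set w | infinite_set (open_cluster w 0)].

Definition origin_to_sphere n (K : nat) : set ('rV[int]_n -> bool) :=
  [set w | exists2 y, open_cluster w 0 y & linf_dist 0 y = K].

Definition mutually_independent d d' (T : measurableType d)
    (T' : measurableType d') (R : realType) (P : probability T R)
    (J : choiceType) (X : J -> {RV P >-> T'}) : Prop :=
  forall (F : {fset J}) (B : J -> set T'),
    (forall j, j \in F -> measurable (B j)) ->
    P (\bigcap_(j in [set` F]) (X j @^-1` B j)) =
      (\prod_(j <- F) P (X j @^-1` B j))%E.

(* Joint independence over all pairs (I, u): this covers both independence
   inside each family omega_I and independence between the families. *)
Definition bernoulli_families n k (R : realType) (p : ksubset n k -> R)
    d (T : measurableType d) (P : probability T R)
    (omega : forall I : ksubset n k, coord_plane I -> {RV P >-> bool}) : Prop :=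
  (forall (I : ksubset n k) (u : coord_plane I) (A : set bool),
     distribution P (omega I u) A = bernoulli_prob (p I) A) /\
  mutually_independent
    (fun j : {I : ksubset n k & coord_plane I} => omega (tag j) (tagged j)).

(* Main.v *)
(** Fix a coordinate axis [a] and let S be a monotone staircase
    [0 <= v_i <= m], [v_j <= v_i <= v_j + 1] ([i < j]) in the other coordinates.
    The cluster of the origin is confined to the tube [0..K] x S, whose
    cross-section has only O(m) sites: since S is cut out by conditions on pairs
    of coordinates and [2 <= k <= n - 1], closing O(m) variables of the planes
    that do not contain [a] closes all sites around the tube, over its whole
    length.  With [m] of order [log K] this costs a power of [K].  Inside the
    tube only the planes containing [a] matter, and there the process dominates
    a high-density percolation with finite-range dependence on a strip of length
    [K] and height [m], which is crossed with probability at least 1/2 as soon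
    as [m >= C log K].  The crossing is the Lipschitz surface of Lipschitz
    percolation, so that the Peierls estimate needs no planar duality. *)
Require Import Defs.
From HB Require Import structures.
From mathcomp Require Import all_boot all_order all_algebra finmap.
From mathcomp Require Import all_classical all_reals all_analysis.
From mathcomp Require Import zify ring lra.

Set Implicit Arguments.
Unset Strict Implicit.
Unset Printing Implicit Defensive.

Import Order.TTheory GRing.Theory Num.Theory.
(* mathcomp-analysis shadows [Defs.adjacent]. *)
Import Defs.

Local Open Scope classical_set_scope.
Local Open Scope ring_scope.

(** Serves to enlarge one or two chosen coordinates to the index set of a [k]-plane. *)
Lemma exists_intermediate_set (T : finType) (A B : {set T}) k :
  A \subset B -> (#|A| <= k <= #|B|)%N ->
  exists C : {set T}, [/\ A \subset C, C \subset B & #|C| == k].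
Proof.
move=> AB /andP[Ak]; elim: k Ak => [|k IHk] Ak kB.
  by exists A; split=> //; rewrite -leqn0.
have [eqAk|neAk] := eqVneq #|A| k.+1; first by exists A; rewrite eqAk.
have [||C [AC CB /eqP cardC]] := IHk; [lia | lia |].
have /properP[_ [x xB xC]] : C \proper B by rewrite properEcard CB; lia.
exists (x |: C); split; last by rewrite cardsU1 xC cardC.
  exact: fintype.subset_trans AC (finset.subsetUr _ _).
by rewrite finset.subUset finset.sub1set xB.
Qed.

(** * Lattice paths and the staircase cross-section *)

Section Lattice.
Variable n : nat.
Implicit Types (u v w : 'rV[int]_n) (f : 'I_n -> int) (I : {set 'I_n}).

Lemma adjacent_off u v (i : 'I_n) :
  (forall j, j != i -> u 0 j = v 0 j) -> `|u 0 i - v 0 i| = 1 -> adjacent u v.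
Proof.
move=> eq_uv d1; rewrite /adjacent (bigD1 i) //= big1 ?addr0 => [|j /eq_uv->].
  by rewrite -real_normK ?num_real // d1 expr1n.
by rewrite subrr expr0n.
Qed.

Lemma adjacent_sym u v : adjacent u v = adjacent v u.
Proof.
rewrite /adjacent; congr (_ == _); apply: eq_bigr => i _.
by rewrite -opprB sqrrN.
Qed.

Lemma adjacentP u v : adjacent u v ->
  exists2 i, forall j, j != i -> u 0 j = v 0 j & `|u 0 i - v 0 i| = 1.
Proof.
rewrite /adjacent => /eqP sum1.
have sq_ge0 (x : int) : 0 <= x ^+ 2 by rewrite -real_normK ?num_real // exprn_ge0.
have [i ne_i] : exists i, u 0 i != v 0 i.
  apply: contrapT => /forallNP eq_uv; move: sum1; rewrite big1 // => i _.
  by have /negP := eq_uv i; rewrite negbK => /eqP->; rewrite subrr expr0n.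
have norm_ge1 : 1 <= `|u 0 i - v 0 i| by lia.
have sq_ge1 : 1 <= (u 0 i - v 0 i) ^+ 2.
  by rewrite -real_normK ?num_real // exprn_ege1.
move: sum1; rewrite (bigD1 i) //= => sum1.
have rest_ge0 : 0 <= \sum_(j | j != i) (u 0 j - v 0 j) ^+ 2 by apply: sumr_ge0.
have rest0 : \sum_(j | j != i) (u 0 j - v 0 j) ^+ 2 = 0.
  by move: sum1 sq_ge1 rest_ge0; set r := \sum_(_ | _) _; set q := _ ^+ 2; lia.
exists i => [j ji|]; last first.
  by apply/eqP; rewrite -sqrp_eq1 // real_normK ?num_real // -sum1 rest0 addr0.
apply/eqP; rewrite -subr_eq0 -sqrf_eq0.
have /psumr_eq0P := rest0; move=> /(_ (fun j _ => sq_ge0 _)) /(_ j ji) ->.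
by [].
Qed.

Lemma open_cluster_step (om : 'rV[int]_n -> bool) x y z :
  open_cluster om x y -> y = z \/ adjacent y z -> om z -> open_cluster om x z.
Proof.
move=> xy [<-//|yz] omz; case: xy => s [xs lasts /andP[omx oms]].
exists (rcons s z); split; last by rewrite /= all_rcons omz omx.
  by rewrite rcons_path xs lasts.
by rewrite last_rcons.
Qed.

Lemma open_cluster_ind (om : 'rV[int]_n -> bool) x (Q : set 'rV[int]_n) :
  (om x -> Q x) ->
  (forall y z, Q y -> adjacent y z -> om z -> Q z) ->
  open_cluster om x `<=` Q.
Proof.
move=> Qx Qstep _ [s [+ <- /=]] => + /andP[/Qx {}Qx].
elim: s x Qx => //= z s IHs x Qx /andP[xz zs] /andP[omz oms].
by apply: IHs => //; apply: Qstep xz _.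
Qed.

Variable a : 'I_n.

Definition site (x : int) f : 'rV[int]_n :=
  \row_i (if i == a then x else f i).

Lemma site_axis x f : site x f 0 a = x.
Proof. by rewrite mxE eqxx. Qed.

Lemma site_off x f i : i != a -> site x f 0 i = f i.
Proof. by rewrite mxE => /negPf->. Qed.

Lemma siteE v : v = site (v 0 a) (v 0).
Proof. by apply/rowP => i; rewrite mxE; case: eqP => [->|]. Qed.

Definition diag (x j : nat) : 'rV[int]_n := site x%:Z (fun=> j%:Z).

(* The tube runs along the axis [a]; its cross-section is the monotone staircase
   in the remaining coordinates.  All the constraints involve at most two
   coordinates, so that a violation is visible in a projection to a k-plane. *)
Definition staircase (m : nat) I v : bool :=
  [forall i in I, 0 <= v 0 i <= m%:Z] &&
  [forall i in I, forall j in I, (i < j)%N ==> (v 0 j <= v 0 i <= v 0 j + 1)].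

Lemma staircaseP m I v :
  reflect ((forall i, i \in I -> 0 <= v 0 i <= m%:Z) /\
           (forall i j, i \in I -> j \in I -> (i < j)%N ->
              v 0 j <= v 0 i <= v 0 j + 1))
          (staircase m I v).
Proof.
apply: (iffP andP) => -[].
  move=> /forall_inP bv /forall_inP mv; split=> // i j iI jI.
  by have /forall_inP/(_ j jI)/implyP := mv i iI.
move=> bv mv; split; apply/forall_inP => // i iI.
by apply/forall_inP => j jI; apply/implyP; apply: mv.
Qed.

Lemma staircase_proj m I v : staircase m I (coord_proj I v) = staircase m I v.
Proof.
have projE i : i \in I -> coord_proj I v 0 i = v 0 i by rewrite mxE => ->.
apply/staircaseP/staircaseP => -[bv mv]; split=> [i iI|i j iI jI].
- by have := bv i iI; rewrite projE.
- by have := mv i j iI jI; rewrite !projE.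
- by have := bv i iI; rewrite projE.
- by have := mv i j iI jI; rewrite !projE.
Qed.

Lemma sub_staircase m I I' v :
  I \subset I' -> staircase m I' v -> staircase m I v.
Proof.
move=> /fintype.subsetP sub /staircaseP[bv mv]; apply/staircaseP.
by split=> [i /sub/bv//|i j /sub iI /sub jI]; apply: mv.
Qed.

(** Each defining inequality concerns a pair of coordinates (with [i = j] for the bounds), so the
    offending pair can be padded to a [k]-set inside [I]. *)
Lemma staircase_violation m k I v :
  (2 <= k <= #|I|)%N -> ~~ staircase m I v ->
  exists I' : {set 'I_n}, [/\ I' \subset I, #|I'| == k & ~~ staircase m I' v].
Proof.
move=> k2 nst.
have [i [j [iI jI nij]]] :
    exists i j, [/\ i \in I, j \in I & ~~ staircase m [set i; j]%SET v].
  move: nst; rewrite negb_and => /orP[] /forall_inPn[i iI].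
    move=> nb; exists i, i; split=> //; apply/staircaseP => -[bv _].
    by rewrite bv ?in_set2 ?eqxx in nb.
  move=> /forall_inPn[j jI]; rewrite negb_imply => /andP[ij nm].
  exists i, j; split=> //; apply/staircaseP => -[_ mv].
  by rewrite mv ?in_set2 ?eqxx ?orbT in nm.
have ijI : [set i; j]%SET \subset I.
  by apply/fintype.subsetP => l; rewrite in_set2 => /orP[] /eqP->.
have [|C [ijC CI cardC]] := @exists_intermediate_set _ _ _ k ijI.
  by case/andP: k2 => k2 ->; rewrite cards2 andbT (leq_trans _ k2) //; case: eqP.
by exists C; split=> //; apply: contra nij; apply: sub_staircase.
Qed.

(** Take [j] to be the smallest off-axis coordinate: the order inequalities, read on either side of
    its index, keep every other one within [1] of it. *)
Lemma staircase_window m v : (1 < n)%N -> staircase m [set~ a]%SET v ->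
  exists2 j : nat, (j <= m)%N & forall i, i != a -> j%:Z <= v 0 i <= j%:Z + 1.
Proof.
move=> n1 /staircaseP[bv mv].
have [i1 i1a] : exists i1, i1 != a.
  have /card_gt1P[x [y [_ _ xy]]] : (1 < #|'I_n|)%N by rewrite card_ord.
  have [xa|] := eqVneq x a; last by exists x.
  by exists y; rewrite -xa eq_sym.
pose i0 := [arg min_(i < i1 | i != a) v 0 i]%O.
have [i0a i0min] : i0 != a /\ forall i, i != a -> v 0 i0 <= v 0 i.
  by rewrite /i0; case: arg_minP => // i ia imin; split.
have inI i : i != a -> i \in [set~ a]%SET by rewrite !inE.
have := bv _ (inI _ i0a) => bv0.
exists `|(v 0%R i0)%R|%N => [|i ia]; first by lia.
have := i0min _ ia.
have [lt|lt|/val_inj ->] := ltngtP i i0; last by lia.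
- by have := mv _ _ (inI _ ia) (inI _ i0a) lt; lia.
- by have := mv _ _ (inI _ i0a) (inI _ ia) lt; lia.
Qed.

(** Interpolates between [diag x j] and [diag x j.+1]. Raising the coordinates of lowest index first
    is what keeps the path in the staircase. *)
Definition climb (x j r : nat) : 'rV[int]_n :=
  site x%:Z (fun i => (j + (i < r))%N%:Z).

Lemma climb0 x j : climb x j 0 = diag x j.
Proof. by apply/rowP => i; rewrite !mxE ltn0 addn0. Qed.

Lemma climb_full x j : climb x j n = diag x j.+1.
Proof. by apply/rowP => i; rewrite !mxE ltn_ord addn1. Qed.

Lemma climb_step x j r : (r < n)%N ->
  climb x j r = climb x j r.+1 \/ adjacent (climb x j r) (climb x j r.+1).
Proof.
move=> rn; have [ra|ra] := eqVneq (Ordinal rn) a.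
  (* When the next index is [a] nothing moves, because [site] fixes that coordinate. *)
  left; apply/rowP => i; rewrite !mxE; case: (eqVneq i a) => // ia.
  suff : (i : nat) != r by lia.
  by apply: contra ia => /eqP ir; rewrite -ra; apply/eqP/val_inj.
right; apply: (@adjacent_off _ _ (Ordinal rn)) => [i ir|].
  rewrite !mxE; case: eqP => // _; suff : (i : nat) != r by lia.
  by rewrite -[r]/(val (Ordinal rn)) (inj_eq val_inj).
by rewrite !mxE (negPf ra) /= ltnn ltnSn addn0 addn1; lia.
Qed.

Lemma climb_staircase m x j r : (j < m)%N ->
  staircase m [set~ a]%SET (climb x j r).
Proof.
move=> jm; apply/staircaseP; split=> [i|i i']; rewrite !inE.
  by move=> /site_off->; lia.
by move=> /site_off-> /site_off->; lia.
Qed.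

Lemma diag_staircase m x j : (j <= m)%N -> staircase m [set~ a]%SET (diag x j).
Proof.
move=> jm; apply/staircaseP; split=> [i|i i']; rewrite !inE.
  by move=> /site_off->; lia.
by move=> /site_off-> /site_off->; lia.
Qed.

Lemma diag_adjacent x j : adjacent (diag x j) (diag x.+1 j).
Proof.
apply: (@adjacent_off _ _ a) => [i ia|]; first by rewrite !site_off.
by rewrite !site_axis; lia.
Qed.

Lemma linf_dist_diag x j : (1 < n)%N -> linf_dist 0 (diag x j) = maxn x j.
Proof.
move=> n1; have norm_diag (i : 'I_n) :
    `|((0 : 'rV[int]_n) 0 i - diag x j 0 i)%R|%N = if i == a then x else j.
  by rewrite !mxE; case: ifP; lia.
apply/eqP; rewrite eqn_leq; apply/andP; split.
  apply/bigmax_leqP => i _; rewrite norm_diag; case: ifP => _; lia.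
have [i ia] : exists i : 'I_n, i != a.
  have /card_gt1P[i [i' [_ _ ii']]] : (1 < #|'I_n|)%N by rewrite card_ord.
  have [ia|] := eqVneq i a; last by exists i.
  by exists i'; rewrite -ia eq_sym.
rewrite geq_max; apply/andP; split; rewrite /linf_dist.
  by apply: leq_trans (leq_bigmax a); rewrite norm_diag eqxx.
by apply: leq_trans (leq_bigmax i); rewrite norm_diag (negPf ia).
Qed.
End Lattice.

(** * Lipschitz percolation on a finite grid *)

Section Lipschitz.
Variables (K m : nat) (bad : nat -> nat -> bool).

Let grid := ('I_K.+1 * 'I_m.+1)%type.

(* Admissible paths of Lipschitz percolation: they move up only out of bad
   blocks and diagonally down for free.  The maximal height that they reach over
   each column is then a Lipschitz function through good blocks. *)
Definition admissible : rel grid := fun y z =>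
  [&& z.1 == y.1 :> nat, z.2 == y.2.+1 :> nat & bad y.1 y.2] ||
  ((y.2 == z.2.+1 :> nat) &&
   ((z.1 == y.1.+1 :> nat) || (y.1 == z.1.+1 :> nat))).

Fixpoint up_sources (z : grid) (p : seq grid) : seq grid :=
  if p is y :: p' then
    if (z.2 < y.2)%N then z :: up_sources y p' else up_sources y p'
  else [::].

(** Every step changes the height by exactly one, so the net rise is the number of up-steps minus
    the number of down-steps. *)
Lemma size_up_sources z p : path admissible z p ->
  (z.2 + (size (up_sources z p)).*2 = (last z p).2 + size p)%N.
Proof.
elim: p z => [|y p IHp] z /=; first by rewrite double0.
move=> /andP[zy /IHp]; move: zy; rewrite /admissible.
by case: ltnP => /= zy /orP[/and3P[]|/andP[]]; lia.
Qed.

Lemma up_sources_subseq z p : subseq (up_sources z p) (z :: p).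
Proof.
elim: p z => [|y p IHp] z //; rewrite [up_sources _ _]/=.
case: ifP => _; first by rewrite [subseq _ _]/= eqxx; exact: IHp.
exact: subseq_trans (IHp y) (subseq_cons _ _).
Qed.

Lemma up_sources_size z p : (size (up_sources z p) <= size p)%N.
Proof.
elim: p z => [|y p IHp] z //=; case: ifP => _ /=; first exact: IHp.
exact: leq_trans (IHp y) (leqnSn _).
Qed.

(** Either some admissible path climbs from height [0] to height [m], or the maximal reachable
    heights form the surface [F]. In the first case the path is made simple and cut to exactly [m]
    steps, which fixes the word length in the Peierls count. *)
Lemma lipschitz_or_admissible_path :
  (exists F : nat -> nat,
      (forall x, (x <= K)%N -> (F x < m)%N && ~~ bad x (F x)) /\
      (forall x, (x < K)%N -> (F x <= (F x.+1).+1)%N && (F x.+1 <= (F x).+1)%N))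
  \/ exists (z : grid) p,
      [/\ z.2 = 0%N :> nat, path admissible z p, uniq (z :: p) & size p = m].
Proof.
pose reach y := [exists x0, connect admissible (x0, ord0) y].
have [/existsP[x /existsP[x0 /connectP[p zp lastp]]]|none] :=
    boolP [exists x, reach (x, ord_max)]; [right|left].
  case/shortenP: zp lastp => q zq uq _ lastq.
  (* Reaching height [m] from height [0] takes at least [m] up-steps. *)
  have size_q : (m <= size q)%N.
    have := size_up_sources zq; rewrite -lastq /=.
    have := up_sources_size (x0, ord0) q.
    by move: (size (up_sources _ _)) (size q) => s t; lia.
  exists (x0, ord0), (take m q); split=> //.
  - by rewrite -(cat_take_drop m q) cat_path in zq; case/andP: zq.
  - move: uq; rewrite -{1}(cat_take_drop m q) -cat_cons cat_uniq.
    by case/and3P.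
  - by rewrite size_takel.
pose F x := \max_(j < m.+1 | reach (inord x, j)) (j : nat).
have reach_step y z : reach y -> admissible y z -> reach z.
  move=> /existsP[x0 cy] yz; apply/existsP; exists x0.
  exact: connect_trans cy (connect1 yz).
have F_ge x (j : 'I_m.+1) : reach (inord x, j) -> (j <= F x)%N.
  pose reach_x (j' : 'I_m.+1) := reach (inord x, j').
  by move=> rj; apply: (@leq_bigmax_cond _ reach_x (@nat_of_ord _)).
have F_reach x : exists2 j : 'I_m.+1, reach (inord x, j) & F x = j.
  have r0 : reach (inord x, ord0) by apply/existsP; exists (inord x).
  pose reach_x (j : 'I_m.+1) := reach (inord x, j).
  have [|j rj Fj] := @eq_bigmax_cond _ reach_x (@nat_of_ord m.+1).
    by apply/card_gt0P; exists ord0.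
  by exists j; [exact: rj | exact: Fj].
have F_lt x : (F x < m)%N.
  have [j rj ->] := F_reach x; rewrite ltn_neqAle -ltnS ltn_ord andbT.
  apply: contra none => /eqP jm; apply/existsP; exists (inord x).
  by rewrite (_ : ord_max = j) //; apply: val_inj.
exists F; split=> x xK.
  (* A bad block at the maximal height would permit one more up-step. *)
  rewrite F_lt /=; apply/negP => badx; have [j rj Fj] := F_reach x.
  have jm : (j.+1 < m.+1)%N by rewrite ltnS -Fj.
  suff /F_ge /= : reach (inord x, Ordinal jm) by rewrite Fj ltnn.
  apply: reach_step rj _; apply/orP; left.
  by rewrite /= !eqxx inordK ?ltnS //= -Fj.
(* A free diagonal step from the top of column [x1] reaches the neighbouring column one level
   lower. *)
have down x1 x2 : (x1 <= K)%N -> (x2 <= K)%N -> x2 = x1.+1 \/ x1 = x2.+1 ->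
    (F x1 <= (F x2).+1)%N.
  move=> x1K x2K x12; have [j rj ->] := F_reach x1.
  case: (posnP j) => [->//|j0].
  have jm : (j.-1 < m.+1)%N by have := ltn_ord j; lia.
  suff /F_ge /= j_le : reach (inord x2, Ordinal jm) by rewrite -(prednK j0).
  apply: reach_step rj _; apply/orP; right; rewrite /= !inordK ?ltnS //.
  by case: x12; lia.
by rewrite !down //; lia.
Qed.
End Lipschitz.

(** * Prescribed variables and confinement of the cluster to the tube *)

Section Tube.
Variables (n k : nat) (a : 'I_n).

Definition pidx := {I : ksubset n k & coord_plane I}.

Definition pvar (I : ksubset n k) (v : 'rV[int]_n) : pidx :=
  Tagged (fun I : ksubset n k => coord_plane I) (plane_proj I v).

Implicit Types (eta : pidx -> bool) (I : ksubset n k) (v : 'rV[int]_n).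

Lemma eq_pvar I v v' :
  (forall i, i \in val I -> v 0 i = v' 0 i) -> pvar I v = pvar I v'.
Proof.
move=> eqv; congr Tagged; apply: val_inj; apply/rowP => i /=.
by rewrite !mxE; case: ifP => // /eqv.
Qed.

Lemma pvar_inj I I' v v' : pvar I v = pvar I' v' ->
  I = I' /\ forall i, i \in val I -> v 0 i = v' 0 i.
Proof.
move=> eqv; have eqI : I = I' := congr1 tag eqv; split=> // i iI.
have /(congr1 (fun u : 'rV[int]_n => u 0 i)) /= :=
  congr1 (fun j : pidx => val (tagged j)) eqv.
by rewrite !mxE -eqI iI.
Qed.

Definition process eta : 'rV[int]_n -> bool :=
  hyperplane_process
    (fun I u => eta (Tagged (fun I : ksubset n k => coord_plane I) u)).

Lemma processP eta v : reflect (forall I, eta (pvar I v)) (process eta v).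
Proof. by rewrite /process /hyperplane_process big_andE; apply: forallP. Qed.

(** On planes avoiding the axis, exactly the visible staircase violations are closed. On planes
    containing it, the test [== 0] opens the starting column and closes both end columns. *)
Definition target (m : nat) (j : pidx) : bool :=
  if a \in val (tag j) then val (tagged j) 0 a == 0
  else staircase m (val (tag j)) (val (tagged j)).

Lemma target_pvar m I v :
  target m (pvar I v) =
  if a \in val I then v 0 a == 0 else staircase m (val I) v.
Proof. by rewrite /target /= staircase_proj mxE; case: ifP => // ->. Qed.

(* The columns of the tube on which the configuration is prescribed: the
   starting column [0] is open, and the two ends [-1] and [K + 1] are closed. *)
Definition end_column (K : nat) (c : option bool) : int :=
  match c with None => 0 | Some false => -1 | Some true => K.+1%:Z end.

(** The four values of [z.2 i] encode the offsets [-1, 0, 1, 2]: the window [{j, j + 1}] of a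
    staircase site, widened by one on each side to include its neighbours. *)
Definition prescribed_var (m K : nat)
    (z : ksubset n k * option bool * 'I_m.+1 * {ffun 'I_n -> 'I_4}) : pidx :=
  pvar z.1.1.1 (site a (end_column K z.1.1.2)
                     (fun i => z.1.2%:Z + (z.2 i)%:Z - 1)).

Definition prescribed (m K : nat) : {fset pidx} :=
  [fset @prescribed_var m K z | z in predT]%fset.

(** The bound is linear in [m] and free of [K]: planes containing the axis are prescribed on three
    columns only, and the other projections forget the column. *)
Lemma card_prescribed m K :
  (#|` prescribed m K| <=
   #|{: ksubset n k * option bool * {ffun 'I_n -> 'I_4}}| * m.+1)%N.
Proof.
apply: leq_trans (leq_imfset_card _ _ _) _.
rewrite -cardE !card_prod card_ord; lia.
Qed.

Lemma prescribedP m K I v : a \in val I -> pvar I v \in prescribed m K ->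
  v 0 a \in [:: 0; -1; K.+1%:Z].
Proof.
move=> aI /imfsetP[[[[I' c] j] g] _ /= /pvar_inj[_ /(_ a aI)]].
by rewrite site_axis => ->; case: c => [[]|]; rewrite !inE eqxx ?orbT.
Qed.

Lemma mem_prescribed m K I v (j : nat) :
  (a \in val I -> v 0 a \in [:: 0; -1; K.+1%:Z]) -> (j <= m)%N ->
  (forall i, i != a -> j%:Z - 1 <= v 0 i <= j%:Z + 2) ->
  pvar I v \in prescribed m K.
Proof.
move=> va jm vj.
have [c ac] : exists c, a \in val I -> end_column K c = v 0 a.
  case: (boolP (a \in val I)) => [/va|_]; last by exists None.
  by rewrite !inE => /or3P[] /eqP->;
    [exists None | exists (Some false) | exists (Some true)].
apply/imfsetP => /=.
exists (I, c, inord j, [ffun i => inord `|(v 0%R i - j%:Z + 1)%R|%N]) => //=.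
apply: eq_pvar => i iI; have [ia|ia] := eqVneq i a.
  by rewrite ia site_axis ac // -ia.
rewrite site_off // ffunE !inordK ?ltnS //; have := vj i ia; lia.
Qed.

Definition has_prescribed (m K : nat) eta :=
  forall j, j \in prescribed m K -> eta j = target m j.

Definition tube (m K : nat) : set 'rV[int]_n :=
  [set v : 'rV[int]_n | 0 <= v 0 a <= K%:Z /\ staircase m [set~ a]%SET v].

Lemma finite_tube m K : finite_set (tube m K).
Proof.
pose f (z : 'I_K.+1 * {ffun 'I_n -> 'I_m.+1}) : 'rV[int]_n :=
  site a (z.1)%:Z (fun i => (z.2 i)%:Z).
apply: (@sub_finite_set _ _ (f @` setT)); last exact/finite_image/finite_finset.
move=> v [va /staircaseP[bv _]].
exists (inord `|v 0%R a|%N, [ffun i => inord `|v 0%R i|%N]) => //.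
rewrite [RHS](siteE a); apply/rowP => i; rewrite !mxE /= ffunE.
case: eqVneq => [_|ia].
  by rewrite inordK; lia.
have /bv vi : i \in [set~ a]%SET by rewrite !inE.
by rewrite inordK; lia.
Qed.

Hypotheses (n_ge3 : (3 <= n)%N) (k_bounds : (2 <= k <= n - 1)%N).

Lemma exists_off_axis I : exists2 i, i \in val I & i != a.
Proof.
have /card_gt1P[i [j [iI jI ij]]] : (1 < #|val I|)%N.
  by rewrite (eqP (valP I)); case/andP: k_bounds.
have [ia|] := eqVneq i a; last by exists i.
by exists j; rewrite // -ia eq_sym.
Qed.

Lemma exists_axis_plane : exists I : ksubset n k, a \in val I.
Proof.
have [||C [aC _ cardC]] := @exists_intermediate_set _ [set a]%SET finset.setT k.
- exact: finset.subsetT.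
- by rewrite cards1 cardsT card_ord; lia.
by exists (exist _ C cardC); rewrite -finset.sub1set.
Qed.

Variables (m K : nat) (eta : pidx -> bool).
Hypothesis eta_prescribed : has_prescribed m K eta.

Lemma prescribed_off_axis I v (j : nat) : a \notin val I -> (j <= m)%N ->
  (forall i, i != a -> j%:Z - 1 <= v 0 i <= j%:Z + 2) ->
  eta (pvar I v) = staircase m (val I) v.
Proof.
move=> aI jm vj; rewrite eta_prescribed ?target_pvar ?(negPf aI) //.
by apply: mem_prescribed vj => //; rewrite (negPf aI).
Qed.

(** Follow the cluster until a step leaves the tube. If the staircase breaks, a violation shows on a
    [k]-set avoiding [a], available since [k <= n - 1], and its variable is prescribed closed. *)
Lemma open_cluster_tube : open_cluster (process eta) 0 `<=` tube m K.
Proof.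
apply: open_cluster_ind => [_|v v' [va stv] adj openv'].
  rewrite /tube /= mxE; split; first by lia.
  by apply/staircaseP; split=> [i|i j] *; rewrite !mxE; lia.
have [j jm vj] := staircase_window (ltnW n_ge3) stv.
have [i eqv di] := adjacentP adj.
have near i' : i' != a -> j%:Z - 1 <= v' 0 i' <= j%:Z + 2.
  move=> i'a; have := vj i' i'a; have [->|/eqv->] := eqVneq i' i; lia.
have stv' : staircase m [set~ a]%SET v'.
  apply/negPn/negP => /(@staircase_violation _ _ k)[|I [Ia cardI]].
    by have := cardsC1 a; rewrite card_ord => ->; lia.
  rewrite -(@prescribed_off_axis (exist _ I cardI) _ j) //=.
    exact/negP/negPn/processP.
  apply: contraTN isT => aI.
  by move/fintype.subsetP/(_ a aI): Ia; rewrite !inE eqxx.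
split=> //; have [ia|ia] := eqVneq i a; last by rewrite -eqv // eq_sym.
have [I aI] := exists_axis_plane.
have /processP/(_ I) etaI := openv'.
(* The remaining exits are through the two end columns, which any plane containing [a] closes. *)
have : v' 0 a \notin [:: -1; K.+1%:Z].
  apply/negP => va'; move: etaI; rewrite eta_prescribed.
    by rewrite target_pvar aI => /eqP v0; rewrite v0 in va'.
  apply: (@mem_prescribed _ _ _ _ j) => // _.
  by rewrite inE va' orbT.
by move: di va; rewrite ia !inE; lia.
Qed.

Lemma open_tube v : tube m K v ->
  (forall I, a \in val I -> eta (pvar I v)) -> process eta v.
Proof.
move=> [va stv] open_axis; apply/processP => I.
have [/open_axis//|aI] := boolP (a \in val I).
have [j jm vj] := staircase_window (ltnW n_ge3) stv.
rewrite (@prescribed_off_axis _ _ j) //.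
  apply: sub_staircase stv; apply/fintype.subsetP => i iI.
  by rewrite !inE; apply: contraNneq aI => <-.
by move=> i /vj; lia.
Qed.

Lemma open_start_column v : v 0 a = 0 -> staircase m [set~ a]%SET v ->
  process eta v.
Proof.
move=> va stv; apply: open_tube => [|I aI].
  by split=> //; rewrite va; lia.
have [j jm vj] := staircase_window (ltnW n_ge3) stv.
rewrite eta_prescribed ?target_pvar ?aI ?va //.
apply: (@mem_prescribed _ _ _ _ j) => [|//|i /vj]; last by lia.
by rewrite va.
Qed.

(** * Blocks, crossings and the words that obstruct them *)

Definition block_choice : Type := (ksubset n k * {ffun 'I_n -> bool})%type.

Definition block_var (x j : nat) (c : block_choice) : pidx :=
  pvar c.1 (site a x%:Z (fun i => (j + c.2 i)%N%:Z)).

(* The block at height [j] over column [x] consists of the sites whose off-axis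
   coordinates are [j] or [j + 1]. *)
Definition bad_block (x j : nat) : bool :=
  [exists c : block_choice, (a \in val c.1) && ~~ eta (block_var x j c)].

Lemma open_block x j v : (x <= K)%N -> (j < m)%N -> ~~ bad_block x j ->
  v 0 a = x%:Z -> (forall i, i != a -> j%:Z <= v 0 i <= j%:Z + 1) ->
  staircase m [set~ a]%SET v -> process eta v.
Proof.
move=> xK jm /existsPn good va vj stv; apply: open_tube => [|I aI].
  by split=> //; rewrite va; lia.
have := good (I, [ffun i => v 0 i != j%:Z]); rewrite aI /= negbK.
congr (is_true (eta _)); apply: eq_pvar => i iI.
have [->|ia] := eqVneq i a; first by rewrite site_axis.
by rewrite site_off // ffunE; have := vj i ia; case: eqP => /=; lia.
Qed.

Lemma open_cluster_climb x j :
  (forall r, process eta (climb a x j r)) ->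
  open_cluster (process eta) 0 (diag a x j) ->
  open_cluster (process eta) 0 (diag a x j.+1).
Proof.
move=> open_climb; rewrite -climb0 -climb_full => c0.
suff: forall r, (r <= n)%N ->
    open_cluster (process eta) 0 (climb a x j r) by apply.
elim=> [//|r IHr] rn; apply: open_cluster_step (IHr (ltnW rn)) _ (open_climb _).
exact: climb_step.
Qed.

Lemma open_cluster_descend x j :
  (forall r, process eta (climb a x j r)) ->
  open_cluster (process eta) 0 (diag a x j.+1) ->
  open_cluster (process eta) 0 (diag a x j).
Proof.
move=> open_climb; rewrite -(climb0 a x j) -(climb_full a x j) => cn.
suff /(_ n) : forall r, (r <= n)%N ->
    open_cluster (process eta) 0 (climb a x j (n - r)) by rewrite subnn; apply.
elim=> [|r IHr] rn; first by rewrite subn0.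
apply: open_cluster_step (IHr (ltnW rn)) _ (open_climb _).
have [|eqc|adj] := @climb_step _ a x j (n - r.+1); first by lia.
  by left; rewrite eqc -subSn.
by right; rewrite adjacent_sym -[(n - r)%N]subSS subSn.
Qed.

Lemma open_cluster_start_column j : (j <= m)%N ->
  open_cluster (process eta) 0 (diag a 0 j).
Proof.
elim: j => [|j IHj] jm.
  have -> : diag a 0 0 = 0 by apply/rowP => i; rewrite !mxE; case: ifP.
  exists [::]; split=> //=; rewrite andbT open_start_column ?mxE //.
  by apply/staircaseP; split=> [i|i i'] *; rewrite !mxE; lia.
apply: open_cluster_climb (IHj (ltnW jm)) => r.
by apply: open_start_column; [rewrite site_axis | apply: climb_staircase].
Qed.

(** Climb the open starting column to height [F 0], then follow the surface column by column through
    good blocks. *)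
Lemma origin_to_sphere_lipschitz (F : nat -> nat) : (0 < m)%N ->
  (forall x, (x <= K)%N -> (F x < m)%N && ~~ bad_block x (F x)) ->
  (forall x, (x < K)%N -> (F x <= (F x.+1).+1)%N && (F x.+1 <= (F x).+1)%N) ->
  origin_to_sphere K (process eta).
Proof.
move=> m0 goodF lipF.
(* For [K <= m] the starting column already meets the sphere; otherwise the crossing ends in column
   [K] at a height below [K]. *)
have [Km|mK] := leqP K m.
  exists (diag a 0 K); first exact: open_cluster_start_column.
  by rewrite linf_dist_diag ?max0n // ltnW.
have open_diag x j : (x <= K)%N -> (j = F x) \/ (j = (F x).+1) ->
    process eta (diag a x j).
  move=> xK jF; have /andP[Fm good] := goodF x xK.
  apply: (open_block xK Fm good); first by rewrite site_axis.
    by move=> i ia; rewrite site_off //; lia.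
  by apply: diag_staircase; case: jF; lia.
have climbF x : (x <= K)%N -> open_cluster (process eta) 0 (diag a x (F x)) ->
    open_cluster (process eta) 0 (diag a x (F x).+1).
  move=> xK; have /andP[Fm good] := goodF x xK.
  apply: open_cluster_climb => r; apply: (open_block xK Fm good).
  - by rewrite site_axis.
  - by move=> i ia; rewrite site_off //; lia.
  - exact: climb_staircase.
have reachF x : (x <= K)%N -> open_cluster (process eta) 0 (diag a x (F x)).
  elim: x => [|x IHx] xK.
    by apply: open_cluster_start_column; have /andP[/ltnW] := goodF 0%N xK.
  have cx := IHx (ltnW xK).
  have /andP[F1 F2] := lipF x xK.
  have horiz j : open_cluster (process eta) 0 (diag a x j) ->
      j = F x.+1 \/ j = (F x.+1).+1 ->
      open_cluster (process eta) 0 (diag a x.+1 j).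
    move=> cj jF; apply: open_cluster_step cj _ _; last exact: open_diag.
    by right; apply: diag_adjacent.
  (* A rise is climbed in column [x] before moving across; a fall is descended in column [x.+1]
     after moving across. Both use only the good block of the column concerned. *)
  have [eqF|] := eqVneq (F x.+1) (F x).
    by rewrite eqF; apply: horiz; rewrite ?eqF //; left.
  have [upF _|] := eqVneq (F x.+1) (F x).+1.
    by apply: horiz; [rewrite upF; apply: climbF (ltnW xK) cx | left].
  move=> ne1 ne2; have downF : F x = (F x.+1).+1 by lia.
  have cdown : open_cluster (process eta) 0 (diag a x.+1 (F x)).
    by apply: horiz cx _; right.
  have /andP[Fm good] := goodF _ xK.
  apply: open_cluster_descend => [r|]; last by rewrite -downF.
  apply: (open_block xK Fm good).
  - by rewrite site_axis.
  - by move=> i ia; rewrite site_off //; lia.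
  - exact: climb_staircase.
exists (diag a K (F K)); first exact: reachF.
rewrite linf_dist_diag ?(ltnW n_ge3) //; apply/maxn_idPl.
by have /andP[] := goodF K (leqnn K); lia.
Qed.
(* A step of an admissible path, with up-steps labelled by a closed variable that
   makes the block bad, and down-steps by their direction. *)
Definition step : Type := (block_choice + bool)%type.

(** The variables depend only on the starting block and the word, so they can be counted by words.
    Predecessors truncate at [0], but never along the word of an admissible path. *)
Fixpoint word_vars (x j : nat) (w : seq step) : seq pidx :=
  match w with
  | [::] => [::]
  | inl c :: w' => block_var x j c :: word_vars x j.+1 w'
  | inr true :: w' => word_vars x.+1 j.-1 w'
  | inr false :: w' => word_vars x.-1 j.-1 w'
  end.

Let grid := ('I_K.+1 * 'I_m.+1)%type.

Fixpoint path_word (ch : grid -> block_choice) (z : grid) (p : seq grid) :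
    seq step :=
  if p is y :: p' then
    (if (z.2 < y.2)%N then inl (ch z) else inr (z.1 < y.1)%N)
      :: path_word ch y p'
  else [::].

Lemma size_path_word ch z p : size (path_word ch z p) = size p.
Proof. by elim: p z => //= y p IHp z; rewrite IHp. Qed.

Lemma word_vars_path ch z p : path (admissible bad_block) z p ->
  word_vars z.1 z.2 (path_word ch z p) =
    [seq block_var y.1 y.2 (ch y) | y : grid <- up_sources z p].
Proof.
elim: p z => [//|y p IHp] z /= /andP[zy /IHp {}IHp]; move: zy.
case/orP => [/and3P[/eqP y1 /eqP y2 _]|/andP[/eqP z2 y1]].
  by rewrite y2 ltnSn /= -IHp y1 y2.
rewrite z2 ltnNge leqnSn /=; case/orP: y1 => /eqP e1.
  by rewrite e1 ltnSn -IHp e1.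
by rewrite e1 ltnNge leqnSn /= -IHp.
Qed.

Lemma up_sources_bad z p : path (admissible bad_block) z p ->
  {in up_sources z p, forall y : grid, bad_block y.1 y.2}.
Proof.
elim: p z => [//|y p IHp] z /= /andP[zy /IHp {}IHp]; case: ifP => // zy2 y'.
rewrite inE => /orP[/eqP->|/IHp//].
by case/orP: zy => [/and3P[]//|/andP[/eqP z2 _]]; rewrite z2 ltnNge leqnSn in zy2.
Qed.

(* A variable of the block at height [j] has an off-axis coordinate in
   [{j, j + 1}], so it determines [j] up to its parity. *)
Lemma block_var_inj x j (c : block_choice) x' j' (c' : block_choice) :
  a \in val c.1 -> block_var x j c = block_var x' j' c' -> odd j = odd j' ->
  x = x' /\ j = j'.
Proof.
move=> ac /pvar_inj[_ eqv] odd_j.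
have := eqv a ac; rewrite !site_axis => -[->]; split=> //.
have [i ic ia] := exists_off_axis c.1.
have := eqv i ic; rewrite !site_off // => -[].
by case: (c.2 i); case: (c'.2 i); lia.
Qed.

(** A path of [m] steps from height [0] has at least [m / 2] up-steps, from distinct blocks. A
    variable and the parity of the height determine the block, so each variable serves at most
    twice, leaving at least [m / 4] distinct ones. *)
Lemma blocked_word : (0 < m)%N -> ~ origin_to_sphere K (process eta) ->
  exists (x : 'I_K.+1) (w : m.-tuple step),
    [/\ forall j, j \in word_vars x 0 w -> ~~ eta j,
        forall j, j \in word_vars x 0 w -> j \notin prescribed m K &
        (m <= 4 * size (undup (word_vars x 0 w)))%N].
Proof.
move=> m0 blocked.
have [[F [goodF lipF]]|] := lipschitz_or_admissible_path K m bad_block.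
  by case: blocked; apply: origin_to_sphere_lipschitz goodF lipF.
move=> [z [p [z0 zp uzp size_p]]].
(* A default for [odflt]; on bad blocks [pick] succeeds. *)
pose c0 : block_choice := (xchoose exists_axis_plane, [ffun=> false]).
pose ch (y : grid) : block_choice :=
  odflt c0 [pick c : block_choice |
              (a \in val c.1) && ~~ eta (block_var y.1 y.2 c)].
have chP (y : grid) : bad_block y.1 y.2 ->
    a \in val (ch y).1 /\ ~~ eta (block_var y.1 y.2 (ch y)).
  move=> /existsP[c cP]; rewrite /ch; case: pickP => [c' /andP//|/(_ c)].
  by rewrite cP.
have size_w : size (path_word ch z p) == m by rewrite size_path_word size_p.
have varsE := word_vars_path ch zp; rewrite z0 in varsE.
have bad_up := up_sources_bad zp.
exists z.1, (Tuple size_w); rewrite /= varsE; split.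
- by move=> j /mapP[y /bad_up/chP[_ ny] ->].
(* Among the grid columns only column [0] is prescribed on planes containing [a], and it is
   prescribed open, whereas the chosen variable is closed. *)
- move=> j /mapP[y /bad_up/chP[ay ny] ->]; apply/negP => pres.
  have := prescribedP ay pres; rewrite site_axis.
  move: ny; rewrite eta_prescribed // target_pvar ay site_axis !inE.
  by move=> /negPf->; case: (y.1) => t /= tK; lia.
set ups := up_sources z p; set f := fun y : grid => block_var y.1 y.2 (ch y).
have size_ups : (m <= (size ups).*2)%N.
  have := size_up_sources zp; rewrite z0 size_p -/ups add0n => ->.
  exact: leq_addl.
pose h (y : grid) := (f y, odd y.2).
have uniq_h : uniq (map h ups).
  rewrite map_inj_in_uniq; first exact: subseq_uniq (up_sources_subseq z p) uzp.
  move=> [y1 y2] [y1' y2'] /bad_up/chP[ay _] _ eqh.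
  have [/= /val_inj-> /val_inj-> //] :=
    block_var_inj ay (congr1 fst eqh) (congr1 snd eqh).
have sub_h : {subset map h ups <=
    [seq (j, b) | j <- undup (map f ups), b <- [:: true; false]]}.
  move=> _ /mapP[y yups ->]; apply/allpairsP; exists (h y) => /=.
  by split=> //; [rewrite mem_undup map_f | case: odd].
have := uniq_leq_size uniq_h sub_h; rewrite size_map size_allpairs /=.
move=> le2; apply: leq_trans size_ups _; rewrite -muln2.
by apply: leq_trans (leq_mul le2 (leqnn 2)) _; rewrite -mulnA mulnC.
Qed.

End Tube.

(** * Measurability of the connection events *)

Section Measurability.
Variables (n : nat) (d : measure_display) (T : measurableType d).
Variable om : T -> 'rV[int]_n -> bool.
Hypothesis measurable_om : forall v, measurable [set t | om t v].

Lemma measurable_open_cluster x y : measurable [set t | open_cluster (om t) x y].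
Proof.
rewrite (_ : mkset _ = \bigcup_(s : seq 'rV[int]_n)
  [set t | [/\ path (@adjacent n) x s, last x s = y & all (om t) (x :: s)]]).
  apply: countable_bigcupT_measurable => // s.
  have measurable_all (r : seq 'rV[int]_n) : measurable [set t | all (om t) r].
    elim: r => [|v r IHr].
      by rewrite (_ : mkset _ = setT) //; apply/seteqP; split=> t.
    rewrite (_ : mkset _ = [set t | om t v] `&` [set t | all (om t) r]).
      exact: measurableI.
    by apply/seteqP; split=> t /= /andP.
  have [[xs lasts]|no] := pselect (path (@adjacent n) x s /\ last x s = y).
    rewrite (_ : mkset _ = [set t | all (om t) (x :: s)]) //.
    by apply/seteqP; split=> t; [case | split].
  rewrite (_ : mkset _ = set0) //.
  by apply/seteqP; split=> t // [xs lasts _]; apply: no.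
by apply/seteqP; split=> t [s]; [exists s | move=> _ ?; exists s].
Qed.

Lemma measurable_origin_to_sphere K :
  measurable [set t | @origin_to_sphere n K (om t)].
Proof.
rewrite (_ : mkset _ = \bigcup_y
  ([set t | open_cluster (om t) 0 y] `&` [set t | linf_dist 0 y = K])).
  apply: countable_bigcupT_measurable => // y; apply: measurableI.
    exact: measurable_open_cluster.
  have [yK|yK] := pselect (linf_dist 0 y = K).
    by rewrite (_ : mkset _ = setT) //; apply/seteqP; split=> t.
  by rewrite (_ : mkset _ = set0) //; apply/seteqP; split=> t.
by apply/seteqP; split=> t [y]; [exists y | move=> _ [cy yK]; exists y].
Qed.

(** A cluster is infinite exactly when no finite list exhausts it, and there are countably many
    lists and sites. *)
Lemma measurable_origin_to_infty :
  measurable [set t | @origin_to_infty n (om t)].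
Proof.
rewrite (_ : mkset _ = ~` \bigcup_(s : seq 'rV[int]_n)
   ~` \bigcup_y ([set t | open_cluster (om t) 0 y] `&` [set t | y \notin s])).
  apply: measurableC; apply: countable_bigcupT_measurable => // s.
  apply: measurableC; apply: countable_bigcupT_measurable => // y.
  apply: measurableI; first exact: measurable_open_cluster.
  have [ys|ys] := boolP (y \in s).
    by rewrite (_ : mkset _ = set0) //; apply/seteqP; split=> t //=; rewrite ys.
  by rewrite (_ : mkset _ = setT) //; apply/seteqP; split=> t //= _.
apply/seteqP; split=> t /=.
  move=> inf [s _ sub]; apply: inf; apply: (sub_finite_set _ (finite_seq s)).
  move=> y cy /=; apply: contrapT => ys; apply: sub; exists y => //.
  by split=> //=; apply/negP.
move=> nosub /finite_seqP[s cs]; apply: nosub; exists s => //.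
by move=> [y _ [/=]]; rewrite cs /= => ->.
Qed.
End Measurability.

(** Union bound, by removing one set of the cover from [B] at a time. *)
Lemma measure_cover_le d (T : measurableType d) (R : realType)
    (P : probability T R) (J : eqType) (s : seq J) (A : J -> set T)
    (B E : set T) (e : R) :
  measurable B -> measurable E -> (forall j, measurable (A j)) ->
  (forall j, (P (A j) <= e%:E)%E) ->
  B `<=` E `|` [set t | exists2 j, j \in s & A j t] ->
  (P B <= P E + (e *+ size s)%:E)%E.
Proof.
move=> mB mE mA PA; elim: s B mB => [|j s IHs] B mB sub.
  rewrite adde0; apply: le_measure; rewrite ?inE //.
  by move=> t /sub[//|[?]].
have mD : measurable (B `\` A j) by apply: measurableD.
have PBA : (P B <= P (B `\` A j) + P (A j))%E.
  apply: le_trans (measureU2 P mD (mA j)).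
  apply: le_measure; rewrite ?inE //; first exact: measurableU.
  by move=> t Bt; have [|] := pselect (A j t); [right | left].
apply: (le_trans PBA); rewrite mulrSr EFinD addeA leeD //; apply: IHs => //.
move=> t [/sub[Et|[i si Ait]] nA]; first by left.
move: si; rewrite inE => /predU1P[eij|si]; last by right; exists i.
by case: nA; rewrite -eij.
Qed.

(** * Cylinder probabilities under independence *)

Section Cylinders.
Variables (n k : nat) (R : realType) (p : ksubset n k -> R).
Variables (d : measure_display) (T : measurableType d) (P : probability T R).
Variable omega : forall I : ksubset n k, coord_plane I -> {RV P >-> bool}.
Hypothesis p01 : forall I, 0 < p I < 1.
Hypothesis omegaP : bernoulli_families p omega.

Definition config (t : T) (j : pidx n k) : bool := omega (tagged j) t.

Definition cylinder (s : seq (pidx n k)) (tau : pidx n k -> bool) : set T :=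
  [set t | forall j, j \in s -> config t j = tau j].

Definition weight (tau : pidx n k -> bool) (j : pidx n k) : R :=
  if tau j then p (tag j) else 1 - p (tag j).

Lemma cylinder_bigcap s tau :
  cylinder s tau = \bigcap_(j in [set` s]) (config^~ j @^-1` [set tau j]).
Proof. by []. Qed.

Lemma measurable_config j (A : set bool) : measurable (config^~ j @^-1` A).
Proof. exact: (measurable_funPTI (omega (tagged j))). Qed.

Lemma measurable_cylinder s tau : measurable (cylinder s tau).
Proof.
rewrite cylinder_bigcap; apply: fin_bigcap_measurable; first exact: finite_seq.
by move=> j _; apply: measurable_config.
Qed.

Lemma probability_config (tau : pidx n k -> bool) j :
  P (config^~ j @^-1` [set tau j]) = (weight tau j)%:E.
Proof.
have [distr _] := omegaP.
have /andP[/ltW p0 /ltW p1] := p01 (tag j).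
have memE (b c : bool) : (b \in [set c]) = (b == c).
  by apply/idP/eqP; rewrite inE.
have := distr (tag j) (tagged j) [set tau j]; rewrite /distribution /pushforward.
rewrite bernoulli_probE ?p0 // => ->; rewrite /weight !diracE !memE.
by case: (tau j); rewrite /= ?mule0 ?mule1 ?adde0 ?add0e.
Qed.

Lemma probability_cylinder s tau : uniq s ->
  P (cylinder s tau) = (\prod_(j <- s) weight tau j)%:E.
Proof.
move=> uniq_s; have [_ indep] := omegaP.
have := indep [fset j in s]%fset (fun j => [set tau j]) (fun _ _ => I).
have perm_s : perm_eq [fset j in s]%fset s.
  by apply: uniq_perm => // j; rewrite !inE.
rewrite (perm_big _ perm_s) /= (eq_bigr (fun j => (weight tau j)%:E)); last first.
  by move=> j _; apply: probability_config.
rewrite prodEFin => <-; congr (P _).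
by apply/seteqP; split=> t /= h j js; apply: h; move: js; rewrite /= !inE.
Qed.

Lemma measurable_process v : measurable [set t | process (config t) v].
Proof.
rewrite (_ : mkset _ = \bigcap_(I in [set: ksubset n k])
   (config^~ (pvar I v) @^-1` [set true])).
  apply: fin_bigcap_measurable => [|I _]; first exact: finite_finset.
  exact: measurable_config.
apply/seteqP; split=> t /=; first by move=> /processP h I _; apply: h.
by move=> h; apply/processP => I; apply: h.
Qed.
End Cylinders.

(** * Elementary estimates on products, powers and logarithms *)

Lemma prodr_ge_expr (R : realFieldType) (J : eqType) (s : seq J) (f : J -> R) b :
  0 <= b -> (forall j, j \in s -> b <= f j) -> b ^+ size s <= \prod_(j <- s) f j.
Proof.
move=> b0; elim: s => [|j s IHs] bf; rewrite ?big_nil // big_cons exprS.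
rewrite ler_pM ?exprn_ge0 ?bf ?mem_head //.
by apply: IHs => i si; rewrite bf // inE si orbT.
Qed.

Lemma prodr_le_expr (R : realFieldType) (J : eqType) (s : seq J) (f : J -> R) b :
  (forall j, j \in s -> 0 <= f j <= b) -> \prod_(j <- s) f j <= b ^+ size s.
Proof.
elim: s => [|j s IHs] fb; rewrite ?big_nil // big_cons exprS.
have /andP[f0 fb_j] := fb j (mem_head j s).
rewrite ler_pM ?IHs // => [|i si]; last by rewrite fb // inE si orbT.
rewrite big_seq; apply: prodr_ge0 => i si.
by have /andP[] : 0 <= f i <= b by rewrite fb // inE si orbT.
Qed.

(** With [alpha = - ln b / ln 2] one has [b = 2 ^ (- alpha)], hence [b ^ m] is the power [- alpha]
    of [2 ^ m], and this power decreases. *)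
Lemma powRN_le_exprn (R : realType) (b : R) : 0 < b < 1 ->
  exists2 alpha, 0 < alpha &
    forall (m : nat) (x : R), 2 ^+ m <= x -> x `^ (- alpha) <= b ^+ m.
Proof.
move=> /andP[b0 b1]; have ln2 : 0 < ln (2 : R) by rewrite ln_gt0 // ltr1n.
exists (- ln b / ln 2) => [|m x mx].
  by rewrite divr_gt0 // oppr_gt0 ln_lt0 // b0.
have x0 : 0 < x by apply: lt_le_trans mx; rewrite exprn_gt0.
have -> : b ^+ m = (2 ^+ m) `^ (ln b / ln 2).
  rewrite -[2 ^+ m]powR_mulrn // -powRrM mulrC powRrM powR_mulrn ?powR_ge0 //.
  congr (_ ^+ _); rewrite [RHS]/powR pnatr_eq0 /=.
  by rewrite divfK ?gt_eqF // lnK.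
have -> : ln b / ln 2 = - (- ln b / ln 2) by rewrite mulNr opprK.
rewrite !powRN lef_pV2 ?posrE ?powR_gt0 ?exprn_gt0 //.
rewrite ge0_ler_powR ?nnegrE ?exprn_ge0 ?(ltW x0) //.
by rewrite divr_ge0 ?(ltW ln2) // oppr_ge0 ltW // ln_lt0 // b0.
Qed.

(** The lower bound on [2 ^ q] beats the number of starting columns in the Peierls sum; the upper
    bound keeps the cost polynomial in [K]. *)
Lemma exists_log2_scale K : (0 < K)%N ->
  exists q, [/\ (0 < q)%N, (K.+1 * 2 <= 2 ^ q)%N & (2 ^ q <= 8 * K)%N].
Proof.
move=> K0; exists (trunc_log 2 (4 * K.+1)).
have /andP[] := @trunc_log_bounds 2 (4 * K.+1) isT isT.
by case: (trunc_log _ _) => [|q]; rewrite ?expn0 !expnS ?expn0; split; lia.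
Qed.

(** * The Peierls estimate on the prescribed cylinder *)

Section LowerBound.
Variables (n k : nat) (a : 'I_n) (R : realType) (p : ksubset n k -> R).
Hypotheses (n_ge3 : (3 <= n)%N) (k_bounds : (2 <= k <= n - 1)%N).
Variables (d : measure_display) (T : measurableType d) (P : probability T R).
Variable omega : forall I : ksubset n k, coord_plane I -> {RV P >-> bool}.
Hypothesis p01 : forall I, 0 < p I < 1.
Hypothesis omegaP : bernoulli_families p omega.
Variable delta : R.
Hypothesis delta_p : forall I, 1 - p I <= delta.
Hypothesis delta_le1 : delta <= 1.

Let event K := [set t | (@origin_to_sphere n K `\` @origin_to_infty n)
                          (process (config omega t))].

Lemma measurable_event K : measurable (event K).
Proof.
apply: measurableD.
  by apply: measurable_origin_to_sphere => v; apply: measurable_process.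
by apply: measurable_origin_to_infty => v; apply: measurable_process.
Qed.

Variables (K q : nat).
Hypothesis q_gt0 : (0 < q)%N.
Let m := (4 * q)%N.

Let vars (z : 'I_K.+1 * m.-tuple (step n k)) := word_vars a z.1 0 z.2.

Definition fresh_long (z : 'I_K.+1 * m.-tuple (step n k)) : bool :=
  all (fun j => j \notin prescribed k a m K) (vars z) &&
  (q <= size (undup (vars z)))%N.

Definition word_target (j : pidx n k) : bool :=
  (j \in prescribed k a m K) && target a m j.

(** Including the prescribed variables in the cylinder replaces conditioning on them. Words that
    cannot arise from a blocked crossing get the empty event, so one bound covers all words. *)
Definition word_event z : set T :=
  if fresh_long z
  then cylinder omega (prescribed k a m K ++ undup (vars z)) word_target
  else set0.

Let prescribed_weight : R :=
  \prod_(j <- prescribed k a m K) weight p (target a m) j.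

Lemma weight_gt0 tau j : 0 < weight p tau j.
Proof. by have := p01 (tag j); rewrite /weight; case: ifP => _; lra. Qed.

Lemma prescribed_weight_gt0 : 0 < prescribed_weight.
Proof. by apply: prodr_gt0 => j _; apply: weight_gt0. Qed.

(** Freshness separates the word variables from the prescribed ones, so independence yields the
    prescribed weight times at least [q] factors [1 - p I <= delta]. *)
Lemma probability_word_event z :
  (P (word_event z) <= (prescribed_weight * delta ^+ q)%:E)%E.
Proof.
have delta0 : 0 <= delta.
  have [I _] := @exists_axis_plane n k a n_ge3 k_bounds.
  by have := p01 I; have := delta_p I; lra.
have w0 := ltW prescribed_weight_gt0.
rewrite /word_event; case: ifP => [/andP[/allP fresh long]|_]; last first.
  by rewrite measure0 lee_fin mulr_ge0 // exprn_ge0.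
rewrite (probability_cylinder p01 omegaP); last first.
  rewrite cat_uniq fset_uniq undup_uniq andbT /=; apply/hasPn => j.
  by rewrite mem_undup => /fresh.
rewrite lee_fin big_cat /=.
have -> : \prod_(j <- prescribed k a m K) weight p word_target j =
    prescribed_weight.
  by apply: eq_big_seq => j js; rewrite /weight /word_target js.
apply: ler_wpM2l => //; apply: le_trans (ler_wiXn2l delta0 delta_le1 long).
apply: prodr_le_expr => j; rewrite mem_undup => /fresh jf.
rewrite ltW ?weight_gt0 //= /weight /word_target (negPf jf) /=.
exact: delta_p.
Qed.

(** The prescription makes the cluster finite, so only the crossing can fail, and then
    [blocked_word] provides a word. The choice [m = 4 * q] turns its count into [q] distinct
    variables. *)
Lemma cylinder_cover :
  cylinder omega (prescribed k a m K) (target a m) `<=`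
  event K `|` [set t | exists2 z, z \in enum {: 'I_K.+1 * m.-tuple (step n k)}
                                   & word_event z t].
Proof.
move=> t cyl_t; have pres : has_prescribed a m K (config omega t) by [].
have finite_cluster : ~ origin_to_infty (process (config omega t)).
  apply; apply: sub_finite_set (finite_tube a m K).
  exact: open_cluster_tube.
have [sphere|blocked] := pselect (origin_to_sphere K (process (config omega t))).
  by left.
have m0 : (0 < m)%N by rewrite /m; lia.
have [x [w [closed fresh long]]] := blocked_word n_ge3 k_bounds pres m0 blocked.
right; exists (x, w); first by rewrite mem_enum.
rewrite /word_event ifT.
  move=> j; rewrite mem_cat mem_undup /word_target => /orP[js|jw].
    by rewrite js cyl_t.
  by rewrite (negPf (fresh j jw)) /=; apply/negbTE/closed.
apply/andP; split; first by apply/allP => j /fresh.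
by move: long; rewrite /m leq_pmul2l.
Qed.

Lemma event_ge_prescribed :
  (prescribed_weight * delta ^+ q) *+ (K.+1 * #|{: step n k}| ^ m)
    <= prescribed_weight / 2 ->
  ((prescribed_weight / 2)%:E <= P (event K))%E.
Proof.
move=> small.
have mw z : measurable (word_event z).
  rewrite /word_event; case: ifP => _; last exact: measurable0.
  exact: measurable_cylinder.
have := measure_cover_le (measurable_cylinder omega _ _)
  (measurable_event K) mw probability_word_event cylinder_cover.
rewrite (probability_cylinder p01 omegaP) ?fset_uniq // -/prescribed_weight.
rewrite -cardE card_prod card_ord card_tuple => cover.
have -> : prescribed_weight / 2 = prescribed_weight - prescribed_weight / 2.
  by lra.
rewrite EFinB leeBlDr //; apply: le_trans cover _.
by rewrite leeD2l // lee_fin.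
Qed.
End LowerBound.

Theorem theorem2 (R : realType) (n k : nat)
    (hn : (3 <= n)%N) (hk : (2 <= k <= n - 1)%N) :
  exists delta : R, 0 < delta < 1 /\
    forall p : ksubset n k -> R,
      (forall I : ksubset n k, 1 - delta < p I < 1) ->
      exists c alpha : R, [/\ 0 < c, 0 < alpha &
        forall (d : measure_display) (T : measurableType d)
          (P : probability T R)
          (omega : forall I : ksubset n k, coord_plane I -> {RV P >-> bool}),
          bernoulli_families p omega ->
          forall K : nat, (0 < K)%N ->
            ((c * K%:R `^ (- alpha))%:E <=
             P [set t | (@origin_to_sphere n K `\` @origin_to_infty n)
                  (hyperplane_process (fun I u => omega I u t))])%E].
Proof.
have n0 : (0 < n)%N by lia.
pose a := Ordinal n0.
pose S := #|{: step n k}|.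
have S2 : (2 <= S)%N by rewrite /S card_sum card_bool leq_addl.
(* Each unit of [q] contributes four letters and one factor [delta], so [delta = D^-1] leaves [2^-1]
   per unit. The alphabet, hence [delta], depends on [n] and [k] only. *)
pose D : R := 2 * S%:R ^+ 4.
have D2 : 2 <= D.
  by rewrite /D ler_peMr // exprn_ege1 // ler1n ltnW.
exists D^-1; split; first by rewrite invr_gt0 invf_lt1; lra.
move=> p p_near1.
have D_le1 : D^-1 <= 1 by rewrite invf_le1; lra.
have p01 I : 0 < p I < 1 by have := p_near1 I; lra.
have delta_p I : 1 - p I <= D^-1 by have := p_near1 I; lra.
(* A common positive lower bound for all [p I] and [1 - p I], hence for the cost of each prescribed
   variable. *)
pose th : R := 2^-1 * \prod_I (p I * (1 - p I)).
have pp0 I : 0 < p I * (1 - p I) by have := p01 I => pI; rewrite mulr_gt0; lra.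
have pp1 I : p I * (1 - p I) <= 1 by have := p01 I; nra.
have th0 : 0 < th by rewrite mulr_gt0 ?invr_gt0 // prodr_gt0.
have th_le I : th <= p I * (1 - p I).
  rewrite /th (bigD1 I) //= mulrCA ler_piMr ?ltW //.
  suff : \prod_(i | i != I) (p i * (1 - p i)) <= 1.
    have : 0 <= \prod_(i | i != I) (p i * (1 - p i)).
      by apply: prodr_ge0 => i _; apply: ltW.
    by lra.
  by apply: prodr_ile1 => i _; rewrite ltW //=.
have th_weight I : th <= p I /\ th <= 1 - p I.
  have /andP[pI0 pI1] := p01 I.
  split; apply: le_trans (th_le I) _; rewrite (ler_piMr, ler_piMl); lra.
have [I0 _] := @exists_axis_plane n k a hn hk.
have th1 : th < 1 by have [] := th_weight I0; have := p01 I0; lra.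
pose kappa := #|{: ksubset n k * option bool * {ffun 'I_n -> 'I_4}}|.
have kappa0 : (0 < kappa)%N.
  by apply/card_gt0P; exists (I0, None, [ffun=> ord0]).
have b01 : 0 < th ^+ (4 * kappa) < 1.
  by rewrite exprn_gt0 //= exprn_ilt1 ?ltW // muln_eq0 /= -lt0n.
have [alpha alpha0 alphaP] := powRN_le_exprn b01.
(* At most [kappa * (4 * q + 1)] variables are prescribed: [th ^+ kappa] pays for the extra [1], [8]
   comes from [2 ^ q <= 8 * K], and [2^-1] is the Peierls loss. *)
exists (2^-1 * th ^+ kappa * 8 `^ (- alpha)), alpha; split=> //.
  by rewrite !mulr_gt0 ?invr_gt0 ?exprn_gt0 ?powR_gt0.
move=> d T P omega omegaP K K0.
have [q [q0 q_ge q_le]] := exists_log2_scale K0.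
have pow_q : K.+1%:R * 2 <= 2 ^+ q :> R by rewrite -natrX -natrM ler_nat.
set W : R := \prod_(j <- prescribed k a (4 * q) K) weight p (target a (4 * q)) j.
have W0 : 0 < W by apply: prescribed_weight_gt0.
have := event_ge_prescribed (a := a) hn hk p01 omegaP delta_p D_le1 (K := K) q0.
rewrite -/W -/S => event_ge; apply: (le_trans _ (event_ge _)).
  rewrite lee_fin -/W.
  have W_ge : th ^+ kappa * th ^+ (4 * kappa) ^+ q <= W.
    rewrite -exprM -exprD.
    apply: (@le_trans _ _ (th ^+ size (prescribed k a (4 * q) K))).
      apply: (ler_wiXn2l (ltW th0) (ltW th1)).
      apply: leq_trans (card_prescribed _ _ _ _) _.
      by rewrite -/kappa mulnS mulnA (mulnC kappa).
    apply: prodr_ge_expr (ltW th0) _ => j _.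
    by have [th_p th_1p] := th_weight (tag j); rewrite /weight; case: ifP.
  have K8 : 2 ^+ q <= 8 * K%:R :> R.
    by rewrite -natrX -natrM ler_nat.
  have := alphaP q _ K8; rewrite powRM ?ler0n // => pow_le.
  apply: (@le_trans _ _ (2^-1 * (th ^+ kappa * th ^+ (4 * kappa) ^+ q))); last first.
    by rewrite [W / 2]mulrC ler_pM2l ?invr_gt0.
  rewrite -!mulrA ler_pM2l ?invr_gt0 // ler_pM2l ?exprn_gt0 //.
(* The Peierls sum, relative to [W], equals [K.+1 / 2 ^ q], at most [1 / 2] by the choice of [q]. *)
rewrite -mulr_natr -mulrA ler_pM2l //.
have S0 : 0 < S%:R ^+ (4 * q) :> R by rewrite exprn_gt0 // ltr0n ltnW.
have -> : D^-1 ^+ q * (K.+1 * S ^ (4 * q))%:R = K.+1%:R / 2 ^+ q.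
  rewrite /D exprVn exprMn -exprM natrM natrX; field.
  by rewrite expf_neq0 ?gt_eqF.
by rewrite ler_pdivrMr ?exprn_gt0 // mulrC ler_pdivlMr.
Qed.
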